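(* Let $X$ be a topological space with the specialisation preorder $\leq$, defined by $x \leq y \Leftrightarrow x \in \overline{\{y\}}$. Define the equivalence relation $\sim$ on $X$ by $x \sim y \Leftrightarrow (x \leq y \text{ and } y \leq x)$. Then $X/\sim$ is a poset under $\leq$ (that is, $[x] \leq [y] \Leftrightarrow x \leq y$), and it can be seen as a subset of $X$: choosing one representative in each equivalence class gives a subset $S \subseteq X$ that meets each $\sim$-class in exactly one point, is in bijection with $X/\sim$ via $s \mapsto [s]$, and on which the restriction of $\leq$ is a partial order corresponding under this bijection to the partial order $[x] \leq [y] \Leftrightarrow x \leq y$ on $X/\sim$. The complement $X \setminus S$ is not, in general, a poset under $\leq$: there exist a topological space $X$ and such a set of representatives $S$ for which the restriction of $\leq$ to $X \setminus S$ is not a partial order.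
   Context: $\overline{\{y\}}$ denotes the closure in $X$ of the singleton $\{y\}$, i.e. the intersection of all closed subsets of $X$ containing $y$ (closures are always taken in $X$). $X/\sim$ ''seen as an abstract subset of $X$'' means that each class $[a] \in X/\sim$ is identified with a chosen element $b \in X$ with $[b]=[a]$. The set $S$ (identified with $X/\sim$) is called the poset part of $X$, and $X \setminus S$ the complementary part of $X$. *)

(* Defs.v *)
From HB Require Import structures.
From mathcomp Require Import all_boot all_order.
From mathcomp Require Import all_classical.
From mathcomp Require Import wochoice.
From mathcomp Require Import topology.

Set Implicit Arguments.
Unset Strict Implicit.
Unset Printing Implicit Defensive.

Local Open Scope classical_set_scope.
Local Open Scope quotient_scope.

Section Specialisation.
Context {X : topologicalType}.

Definition spec_le : rel X := fun x y => `[< closure [set y] x >].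

Definition spec_equiv : rel X := fun x y => spec_le x y && spec_le y x.

Lemma spec_le_refl : reflexive spec_le.
Proof. by move=> x; apply/asboolP; apply: subset_closure. Qed.

Lemma spec_le_trans : transitive spec_le.
Proof.
move=> y x z /asboolP xy /asboolP yz; apply/asboolP; move: xy.
rewrite [X in X x -> _]closureE; apply; split; first exact: closed_closure.
by move=> _ ->.
Qed.

Lemma spec_equiv_refl : reflexive spec_equiv.
Proof. by move=> x; rewrite /spec_equiv spec_le_refl. Qed.

Lemma spec_equiv_sym : symmetric spec_equiv.
Proof. by move=> x y; rewrite /spec_equiv andbC. Qed.

Lemma spec_equiv_trans : transitive spec_equiv.
Proof.
move=> y x z /andP[xy yx] /andP[yz zy].
by rewrite /spec_equiv (spec_le_trans xy yz) (spec_le_trans zy yx).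
Qed.

Canonical spec_equiv_rel :=
  EquivRel spec_equiv spec_equiv_refl spec_equiv_sym spec_equiv_trans.

End Specialisation.

Definition spec_quot (X : topologicalType) : Type :=
  {eq_quot (@spec_equiv_rel X)}.

Definition spec_class {X : topologicalType} (x : X) : spec_quot X :=
  \pi_({eq_quot (@spec_equiv_rel X)}) x.

(* Two classes are compared through some representatives; that the choice of
   representatives is irrelevant is not built in. *)
Definition quot_le {X : topologicalType} : rel (spec_quot X) := fun a b =>
  `[< exists x y : X, [/\ spec_class x = a, spec_class y = b & spec_le x y] >].

Definition representatives {X : topologicalType} (S : set X) : Prop :=
  exists2 r : spec_quot X -> X, cancel r spec_class & S = range r.

Definition restr_le {X : topologicalType} (S : set X) : rel S :=
  relpre (fun s : S => val s) spec_le.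
Arguments restr_le {X} S.

(* Main.v *)
Require Import Defs.
From mathcomp Require Import all_boot all_order.
From mathcomp Require Import all_classical.
From mathcomp Require Import wochoice.
From mathcomp Require Import topology.

Local Open Scope classical_set_scope.

(** Equivalent points lie below and above the same points, so comparing classes through any
    representatives gives the same answer ([quot_le_class]). The preorder thus descends to the
    quotient, where antisymmetry holds because points comparable both ways have been identified. A
    section of the projection has as its range a set that the projection maps bijectively onto the
    quotient ([representatives_bij]), and the order transfers along this bijection. The complement
    fails as soon as some class has three points: two equivalent ones are left over, as in an
    indiscrete space on three points. *)

Lemma spec_classP (X : topologicalType) (x y : X) :
  spec_class x = spec_class y <-> spec_equiv x y.
Proof. exact: rwP2 (eqmodP (@spec_equiv_rel X) x y) idP. Qed.

(** Serves twice: to write an arbitrary class as the class of a point, and to supply a section of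
    the projection. *)
Lemma spec_class_repr (X : topologicalType) :
  cancel (repr : {eq_quot @spec_equiv_rel X}%qT -> X) spec_class.
Proof. exact: reprK. Qed.

Lemma quot_le_class (X : topologicalType) (x y : X) :
  quot_le (spec_class x) (spec_class y) = spec_le x y.
Proof.
apply/asboolP/idP => [[x' [y' [/spec_classP/andP[_ xx']]]]|xy]; last first.
  by exists x, y.
move=> /spec_classP/andP[y'y _] x'y'.
(* The chain is [x <= x' <= y' <= y], its outer links coming from the two equivalences. *)
exact: spec_le_trans xx' (spec_le_trans x'y' y'y).
Qed.

Lemma quot_le_partial_order (X : topologicalType) : partial_order (@quot_le X).
Proof.
split; first split.
- by move=> a; rewrite -[a]spec_class_repr quot_le_class spec_le_refl.
- move=> b a c; rewrite -[a]spec_class_repr -[b]spec_class_repr.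
  by rewrite -[c]spec_class_repr !quot_le_class; apply: spec_le_trans.
- move=> a b; rewrite -[a]spec_class_repr -[b]spec_class_repr.
  (* On points, the antisymmetry hypothesis is literally [spec_equiv]. *)
  by rewrite !quot_le_class => ?; apply/spec_classP.
Qed.

Section Representatives.
Context {X : topologicalType} {S : set X}.
Hypothesis repS : representatives S.

Lemma representatives_inj (s t : X) :
  S s -> S t -> spec_class s = spec_class t -> s = t.
Proof.
by case: repS => r rK -> [a _ <-] [b _ <-]; rewrite !rK => ->.
Qed.

Lemma representatives_unique (a : spec_quot X) :
  exists! s : X, S s /\ spec_class s = a.
Proof.
have [r rK SE] := repS; have Sra : S (r a) by rewrite SE; exists a.
exists (r a); split=> [//|s [Ss sa]].
by apply: representatives_inj => //; rewrite rK sa.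
Qed.

Lemma representatives_bij : bijective (fun s : S => spec_class (val s)).
Proof.
have [r rK SE] := repS.
have Sr a : r a \in S by rewrite SE; apply/mem_set; exists a.
exists (fun a => SigSub (Sr a)) => [s|a]; last exact: rK.
(* The point [r (spec_class (val s))] lies in [S] and in the class of [val s], hence equals
   [val s]. *)
apply/val_inj/representatives_inj; last exact: rK.
- exact: set_mem (Sr _).
- exact: set_mem (valP s).
Qed.

Lemma restr_leE (s t : S) :
  restr_le S s t = quot_le (spec_class (val s)) (spec_class (val t)).
Proof. by rewrite quot_le_class. Qed.

Lemma restr_le_partial_order : partial_order (restr_le S).
Proof.
split; first split.
- by move=> s; exact: spec_le_refl.
- by move=> t s u; exact: spec_le_trans.
(* Antisymmetry, unlike the preorder axioms, is not inherited from [X]; it is pulled back from the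
   quotient along an injective map. *)
- move=> s t; rewrite !restr_leE => /(proj2 (quot_le_partial_order X)).
  exact: (bij_inj representatives_bij).
Qed.

End Representatives.

Lemma representatives_exist (X : topologicalType) :
  exists S : set X, representatives S.
Proof. by eexists; exists repr; first exact: spec_class_repr. Qed.

(** Preimages under a constant map are empty or everything, so this initial topology is the
    indiscrete one. *)
Definition indiscrete3 : topologicalType :=
  initial_topology (fun _ : 'I_3 => true).

Lemma indiscrete3_spec_le (x y : indiscrete3) : spec_le x y.
Proof.
apply/asboolP => B [_ [[U _ <-] Ux sUB]].
(* [Ux] amounts to [U true], which equally places [y] in the preimage of [U]. *)
by exists y; split=> //; apply: sUB.
Qed.

(* One point of the single class is chosen, so the complement keeps two
   equivalent points. *)
Lemma indiscrete3_complement : exists S : set indiscrete3,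
  representatives S /\ ~ partial_order (restr_le (~` S)).
Proof.
pose x0 : indiscrete3 := (ord0 : 'I_3).
pose x1 : indiscrete3 := (lift ord0 ord0 : 'I_3).
pose x2 : indiscrete3 := (ord_max : 'I_3).
exists [set x0]; split.
  exists (fun=> x0) => [a|].
    rewrite -[a]spec_class_repr.
    by apply/spec_classP; rewrite /spec_equiv !indiscrete3_spec_le.
  apply/seteqP; split=> [_ ->|_ [_ _ <-] //].
  by exists (spec_class x0).
have x1S : x1 \in ~` [set x0] by apply/mem_set.
have x2S : x2 \in ~` [set x0] by apply/mem_set.
(* A restricted preorder is still a preorder, so antisymmetry is what must be refuted: it would
   identify the ordinals 1 and 2. *)
case=> _ /(_ (SigSub x1S) (SigSub x2S)).
by rewrite /restr_le /= !indiscrete3_spec_le => /(_ isT)/(congr1 val).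
Qed.

Theorem proposition2p1 :
  (forall X : topologicalType,
    [/\ preorder (@spec_le X),
        [/\ reflexive (@spec_equiv X), symmetric (@spec_equiv X)
          & transitive (@spec_equiv X)]
      & (forall x y : X, spec_class x = spec_class y <-> spec_equiv x y)] /\
    [/\ partial_order (@quot_le X),
        (forall x y : X, quot_le (spec_class x) (spec_class y) = spec_le x y),
        (exists S : set X, representatives S)
      & forall S : set X, representatives S ->
        [/\ (forall a : spec_quot X, exists! s : X, S s /\ spec_class s = a),
            bijective (fun s : S => spec_class (val s)),
            partial_order (restr_le S)
          & forall s t : S,
              restr_le S s t
              = quot_le (spec_class (val s)) (spec_class (val t))]])
  /\
  (exists (X : topologicalType) (S : set X),
    representatives S /\ ~ partial_order (restr_le (~` S))).
Proof.
split; last by exists indiscrete3; exact: indiscrete3_complement.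
move=> X; split; split.
- by split; [exact: spec_le_refl|exact: spec_le_trans].
- by split; [exact: spec_equiv_refl|exact: spec_equiv_sym
            |exact: spec_equiv_trans].
- exact: spec_classP.
- exact: quot_le_partial_order.
- exact: quot_le_class.
- exact: representatives_exist.
- move=> S repS; split.
  + exact: representatives_unique.
  + exact: representatives_bij.
  + exact: restr_le_partial_order.
  + exact: restr_leE.
Qed.
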